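(* Let $q$ be a prime power, let $d_1,\dots,d_m\ge 2$ be integers that all divide $q+1$, and let $G=\prod_{k=1}^m\mathbb{Z}/d_k\mathbb{Z}$, $d=|G|=\prod_{k=1}^m d_k$. Let $T_x$ and $M_y$ ($x,y\in G$) be the translation and modulation operators on $\mathbb{F}_{q^2}^G$. For any nonzero $\varphi\in\mathbb{F}_{q^2}^G$, the collection $\Phi=\{T_xM_y\varphi\}_{x,y\in G}$ is an $(a,da)$-NTF for $\mathbb{F}_{q^2}^G$, where $a=\langle\varphi,\varphi\rangle$.
   Context: $\mathbb{F}_{q^2}^G$ is the space of functions $G\to\mathbb{F}_{q^2}$ with Hermitian form $\langle\varphi,\psi\rangle=\sum_{x\in G}\varphi(x)^q\psi(x)$. Let $\mathbb{T}_q=\{\alpha\in\mathbb{F}_{q^2}:\alpha^{q+1}=1\}$. For each $k$ fix a generator $\omega_k\in\mathbb{T}_q$ of the unique subgroup of order $d_k$. For $x=(x_1,\dots,x_m)$, $y=(y_1,\dots,y_m)$ in $G$ put $\hat y(x)=\prod_{k=1}^m\omega_k^{x_ky_k}$. The operators are $(M_y\varphi)(x)=\hat y(x)\varphi(x)$ and $(T_y\varphi)(x)=\varphi(x-y)$. A finite family $\{\varphi_j\}_{j\in J}$ in a space $V$ with Hermitian form is an $(a,c)$-equal norm tight frame, or $(a,c)$-NTF, if it spans $V$, $\sum_{j\in J}\langle\varphi_j,v\rangle\varphi_j=cv$ for all $v\in V$, and $\langle\varphi_j,\varphi_j\rangle=a$ for all $j\in J$ ($a$ and $c$ may be zero). 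*)

(* Defs.v *)
From HB Require Import structures.
From mathcomp Require Import all_boot all_order all_algebra all_fingroup all_field.
Set Implicit Arguments.
Unset Strict Implicit.
Unset Printing Implicit Defensive.
Import GRing.Theory.
Local Open Scope ring_scope.

Definition prime_power (q : nat) : Prop :=
  exists p e : nat, [/\ prime p, (0 < e)%N & q = (p ^ e)%N].

(* The product of the Z/d_k. Since 'Z_n is Z/n only for n > 1, results about it
   assume 1 < d k for every k. *)
Notation Gprod d := {dffun forall k, 'Z_(d k)}.

Definition Gsub (m : nat) (d : 'I_m -> nat) (x y : Gprod d) : Gprod d :=
  [ffun k : 'I_m => x k - y k].

(* F^o is F as a vector space over itself, so that Ffun F d has its pointwise
   F-vector space structure. *)
Notation Ffun F d := {ffun Gprod d -> F^o}.

Definition hform (F : finFieldType) (q m : nat) (d : 'I_m -> nat)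
    (phi psi : Ffun F d) : F :=
  \sum_(x : Gprod d) (phi x : F) ^+ q * (psi x : F).

Definition Tgroup (F : finFieldType) (q : nat) : {set {unit F}} :=
  [set u : {unit F} | FinRing.uval u ^+ q.+1 == 1].

(* The exponent uses the representatives of x_k and y_k in {0, ..., d_k - 1}. The
   value does not depend on them when omega k ^+ d k = 1. *)
Definition chi (F : finFieldType) (m : nat) (d : 'I_m -> nat)
    (omega : 'I_m -> {unit F}) (y x : Gprod d) : F :=
  \prod_(k < m) FinRing.uval (omega k) ^+ (x k * y k)%N.

Definition modulation (F : finFieldType) (m : nat) (d : 'I_m -> nat)
    (omega : 'I_m -> {unit F}) (y : Gprod d) (phi : Ffun F d) : Ffun F d :=
  [ffun x : Gprod d => chi omega y x * (phi x : F)].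

Definition translation (F : finFieldType) (m : nat) (d : 'I_m -> nat)
    (y : Gprod d) (phi : Ffun F d) : Ffun F d :=
  [ffun x : Gprod d => phi (Gsub x y)].

(* [form] is intended to be Hermitian, conjugate-linear in its first argument. *)
Definition is_NTF (F : fieldType) (V : vectType F) (form : V -> V -> F)
    (J : finType) (Phi : J -> V) (a c : F) : Prop :=
  [/\ <<[seq Phi j | j : J]>>%VS = fullv,
      forall v : V, \sum_(j : J) form (Phi j) v *: Phi j = c *: v
    & forall j : J, form (Phi j) (Phi j) = a].

Lemma card_Gprod (m : nat) (d : 'I_m -> nat) :
  (forall k, (1 < d k)%N) -> #|{: Gprod d}| = (\prod_(k < m) d k)%N.
Proof.
move=> d_gt1; rewrite card_dep_ffun foldrE big_map big_enum /=.
by apply: eq_bigr => k _; rewrite card_ord Zp_cast.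
Qed.

(* Main.v *)
Require Import Defs.
From mathcomp Require Import all_boot all_order all_algebra all_fingroup all_field.
From mathcomp Require Import cyclic.
Set Implicit Arguments.
Unset Strict Implicit.
Unset Printing Implicit Defensive.
Import GRing.Theory.
Local Open Scope ring_scope.

(** Since the values of chi lie in T_q, [chi ^+ q] is the inverse of [chi], so
    orthogonality of characters collapses the sum over the modulations, and the
    sum over the translations of what is left is [a].  When [a = 0] the frame
    identity says nothing about spanning; instead, for any [x], the
    combination of the [T_x M_y phi] over [y] with coefficients
    [chi y (z0 - x) ^+ q] is [d phi(z0 - x)] times the indicator of [z0], and [x]
    can be chosen with [phi(z0 - x) != 0]. *)

(** Lagrange's theorem in the additive group of [R], applied to [1]. *)
Lemma natr_card_finRing (R : finNzRingType) : #|R|%:R = 0 :> R.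
Proof.
by rewrite -cardsT -FinRing.zmodXgE expg_cardG ?inE.
Qed.

Section Gprod.
Variables (m : nat) (d : 'I_m -> nat).
Implicit Types x y z : Gprod d.

Lemma GsubKr z : involutive (Gsub z).
Proof. by move=> x; apply/ffunP=> k; rewrite !ffunE opprB addrC subrK. Qed.

Lemma Gsub_injl z : injective (fun x => Gsub x z).
Proof.
by move=> x y /ffunP e; apply/ffunP=> k; move: (e k); rewrite !ffunE => /addIr.
Qed.

Lemma Gprod_basis (k : 'I_m) : exists e : Gprod d,
  e k = 1 /\ forall j, j != k -> e j = 0.
Proof.
exists [ffun j => if j == k then 1 else 0]; split=> [|j /negPf jk].
  by rewrite ffunE eqxx.
by rewrite ffunE jk.
Qed.

End Gprod.

Section Characters.
Variables (q : nat) (F : finFieldType) (m : nat) (d : 'I_m -> nat).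
Variable omega : 'I_m -> {unit F}.
Hypothesis d_gt1 : forall k, (1 < d k)%N.
Hypothesis omega_order : forall k, #[omega k]%g = d k.
Hypothesis omega_Tgroup : forall k, omega k \in Tgroup F q.
Implicit Types x y u v e : Gprod d.

Lemma uval_expX k i : FinRing.uval (omega k) ^+ i = FinRing.uval (omega k ^+ i)%g.
Proof. by rewrite -FinRing.val_unitX. Qed.

Lemma eq_omegaX k i j :
  (FinRing.uval (omega k) ^+ i == FinRing.uval (omega k) ^+ j)
    = (i == j %[mod d k])%N.
Proof.
by rewrite !uval_expX (inj_eq val_inj) eq_expg_mod_order omega_order.
Qed.

Lemma chi_subl y e x : chi omega (Gsub y e) x * chi omega e x = chi omega y x.
Proof.
rewrite -big_split; apply: eq_bigr => k _ /=; rewrite -exprD -mulnDr.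
apply/eqP; rewrite eq_omegaX ffunE.
(* Addition in ['Z_(d k)] reduces modulo [(Zp_trunc (d k)).+2], which is [d k] because [1 < d k]. *)
have yE : (((y k - e k)%R + e k) %% d k)%N = y k.
  rewrite -[in RHS](subrK (e k) (y k)).
  by congr (_ %% _)%N; rewrite Zp_cast.
by rewrite -modnMmr yE.
Qed.

Lemma chiX_q1 y x : chi omega y x ^+ q * chi omega y x = 1.
Proof.
rewrite -exprSr -prodrXl big1 // => k _.
have := omega_Tgroup k; rewrite inE => /eqP wq.
by rewrite -exprM mulnC exprM wq expr1n.
Qed.

Lemma chi_neq0 y x : chi omega y x != 0.
Proof.
apply: contraTneq (oner_neq0 F) => c0.
by rewrite -(chiX_q1 y x) c0 mulr0 eqxx.
Qed.

(** If [u] and [v] differ at [k], shifting [y] by the basis element [e] at [k] permutes the terms,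
    so the sum is unchanged when multiplied by some [c != 1] and must vanish. *)
Lemma chi_orthogonality u v :
  \sum_y chi omega y u ^+ q * chi omega y v
    = (\prod_(k < m) d k)%:R *+ (u == v).
Proof.
have [<-|/eqP neq_uv] := eqVneq.
  under eq_bigr do rewrite chiX_q1.
  by rewrite sumr_const card_Gprod.
have [k neq_k] : exists k, u k != v k.
  apply/existsP; rewrite -negb_forall; apply/negP => /forallP uv.
  by apply: neq_uv; apply/ffunP => k; apply/eqP.
have [e [ek1 e0]] := Gprod_basis d k.
have chi_e x : chi omega e x = FinRing.uval (omega k) ^+ x k.
  rewrite /chi (bigD1 k) //= big1 => [|j jk]; last by rewrite e0 // muln0.
  by rewrite mulr1 ek1 /= modn_small ?muln1.
set S := LHS; set c := chi omega e u ^+ q * chi omega e v.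
have Sc : S * c = S.
  rewrite /S {1}(reindex_inj (@Gsub_injl _ _ e)) mulr_suml.
  by apply: eq_bigr => y _; rewrite mulrACA -exprMn !chi_subl.
(* Compared with [chiX_q1 e u], [c = 1] would make the powers of [omega k] at [u k] and [v k] equal;
   both exponents are below its order [d k]. *)
have c_neq1 : c != 1.
  rewrite -(chiX_q1 e u) (inj_eq (mulfI _)) ?expf_neq0 ?chi_neq0 //.
  have lt_d x : (x k < d k)%N by rewrite -[ltnRHS](Zp_cast (d_gt1 k)).
  by rewrite !chi_e eq_omegaX !modn_small // eq_sym.
move/eqP: Sc; rewrite -{2}[S]mulr1 -subr_eq0 -mulrBr mulf_eq0 subr_eq0.
by rewrite (negPf c_neq1) orbF => /eqP.
Qed.

Variable phi : Ffun F d.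
Local Notation Phi x y := (translation x (modulation omega y phi)).

Lemma translation_modulationE x y z :
  Phi x y z = chi omega y (Gsub z x) * (phi (Gsub z x) : F).
Proof. by rewrite !ffunE. Qed.

Lemma hform_Phi x y : hform q (Phi x y) (Phi x y) = hform q phi phi.
Proof.
rewrite /hform [RHS](reindex_inj (@Gsub_injl _ _ x)); apply: eq_bigr => z _.
by rewrite translation_modulationE exprMn mulrACA chiX_q1 mul1r.
Qed.

(** Shared by the frame identity and the spanning argument: with [x] fixed, [y] enters [Phi x y z]
    only through a character value, so orthogonality singles out one point. *)
Lemma sum_chi_Phi x w z :
  \sum_y chi omega y (Gsub w x) ^+ q * (Phi x y z : F)
    = (\prod_(k < m) d k)%:R * (phi (Gsub z x) : F) *+ (w == z).
Proof.
under eq_bigr do rewrite translation_modulationE mulrA.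
rewrite -mulr_suml chi_orthogonality (inj_eq (@Gsub_injl _ _ x)).
by rewrite mulrnAl.
Qed.

Lemma frame_identity_at (v : Ffun F d) z :
  \sum_x \sum_y hform q (Phi x y) v * (Phi x y z : F)
    = (\prod_(k < m) d k)%:R * hform q phi phi * (v z : F) :> F.
Proof.
(* Expand the form as a sum over [w] and move the sum over [y] innermost. *)
transitivity (\sum_x \sum_w (phi (Gsub w x) : F) ^+ q * (v w : F)
   * \sum_y chi omega y (Gsub w x) ^+ q * (Phi x y z : F)).
  apply: eq_bigr => x _.
  under [RHS]eq_bigr do rewrite mulr_sumr.
  rewrite exchange_big /=; apply: eq_bigr => y _.
  rewrite mulr_suml; apply: eq_bigr => w _.
  rewrite !translation_modulationE exprMn !mulrA; congr (_ * _ * _).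
  by rewrite [RHS]mulrC mulrA.
transitivity (\sum_x (phi (Gsub z x) : F) ^+ q * (v z : F)
   * ((\prod_(k < m) d k)%:R * (phi (Gsub z x) : F))).
  apply: eq_bigr => x _; rewrite (bigD1 z) //= sum_chi_Phi eqxx mulr1n.
  rewrite [X in _ + X]big1 ?addr0 // => w /negPf wz.
  by rewrite sum_chi_Phi wz mulr0.
(* The involution [x -> z - x] turns the remaining sum over translations into the form of [phi] with
   itself. *)
rewrite /hform [in RHS](reindex_inj (inv_inj (GsubKr z))).
rewrite mulr_sumr mulr_suml; apply: eq_bigr => x _.
by rewrite mulrACA -!mulrA [RHS]mulrCA; do 2!congr (_ * _); rewrite mulrC.
Qed.

Lemma frame_identity (v : Ffun F d) :
  \sum_(xy : Gprod d * Gprod d) hform q (Phi xy.1 xy.2) v *: Phi xy.1 xy.2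
    = ((\prod_(k < m) d k)%:R * hform q phi phi) *: v.
Proof.
apply/ffunP=> z; rewrite sum_ffunE ffunE.
rewrite -(pair_bigA _ (fun x y => (hform q (Phi x y) v *: Phi x y) z)) /=.
rewrite -[RHS]frame_identity_at.
by apply: eq_bigr => x _; apply: eq_bigr => y _; rewrite ffunE.
Qed.

Lemma span_Phi :
  (\prod_(k < m) d k)%:R != 0 :> F -> phi != 0 ->
  <<[seq Phi xy.1 xy.2 | xy : Gprod d * Gprod d]>>%VS = fullv.
Proof.
move=> d_neq0 phi_neq0; apply/eqP; rewrite eqEsubv subvf /=.
set U := <<_>>%VS.
have [w phiw] : exists w, phi w != 0.
  apply/existsP; rewrite -negb_forall; apply: contra phi_neq0 => /forallP phi0.
  by apply/eqP/ffunP => w; rewrite [RHS]ffunE; apply/eqP/phi0.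
have Phi_U x y : Phi x y \in U.
  by apply: memv_span; apply/mapP; exists (x, y); rewrite ?mem_enum.
apply/subvP => v _.
(* [v] is expanded in indicators of points. Translating by [z0 - w] makes [phi] be evaluated at [w]
   when [z = z0], and [c z0] divides out the resulting nonzero factor. *)
pose c z0 : F := (v z0 : F) / ((\prod_(k < m) d k)%:R * (phi w : F)).
pose x z0 := Gsub z0 w.
pose s z0 : Ffun F d :=
  \sum_y (chi omega y (Gsub z0 (x z0)) ^+ q : F) *: Phi (x z0) y.
have -> : v = \sum_z0 c z0 *: s z0.
  apply/ffunP => z; rewrite sum_ffunE.
  have E z0 : (c z0 *: s z0) z = c z0 *
      ((\prod_(k < m) d k)%:R * (phi (Gsub z (x z0)) : F) *+ (z0 == z)).
    rewrite ffunE sum_ffunE -sum_chi_Phi; congr (_ * _); apply: eq_bigr => y _.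
    by rewrite ffunE.
  rewrite (bigD1 z) //= E eqxx mulr1n GsubKr divfK ?mulf_neq0 //.
  by rewrite [X in _ + X]big1 ?addr0 // => z0 /negPf z0z; rewrite E z0z mulr0.
by apply: memv_suml => z0 _; apply/memvZ/memv_suml => y _; apply: memvZ.
Qed.

End Characters.

Theorem proposition6p1 (q : nat) (hq : prime_power q)
    (F : finFieldType) (hF : #|F| = (q ^ 2)%N)
    (m : nat) (d : 'I_m -> nat)
    (hd2 : forall k : 'I_m, (2 <= d k)%N)
    (hdq : forall k : 'I_m, (d k %| q + 1)%N)
    (omega : 'I_m -> {unit F})
    (homega : forall k : 'I_m,
       omega k \in Tgroup F q /\ #|<[omega k]>%g| = d k)
    (phi : Ffun F d) (hphi : phi != 0) :
  let a := hform q phi phi in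
  is_NTF (V := Ffun F d) (hform q (d := d))
    (fun xy : Gprod d * Gprod d => translation xy.1 (modulation omega xy.2 phi))
    a ((\prod_(k < m) d k)%:R * a).
Proof.
have omegaT k : omega k \in Tgroup F q by case: (homega k).
have omega_ord k : #[omega k]%g = d k by case: (homega k).
(* The cardinal [q ^ 2] vanishes in [F], and a field has no nonzero nilpotents. *)
have q0 : q%:R = 0 :> F.
  have := natr_card_finRing F.
  by rewrite hF natrX => /eqP; rewrite expf_eq0 => /andP[_ /eqP].
(* Each [d k] divides [q + 1], which equals 1 in [F]. *)
have d_neq0 : (\prod_(k < m) d k)%:R != 0 :> F.
  rewrite natr_prod; apply/prodf_neq0 => k _.
  apply: contraTneq (oner_neq0 F) => dk0.
  have /dvdnP[r rE] := hdq k.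
  have <- : (q + 1)%:R = 1 :> F by rewrite natrD q0 add0r.
  by rewrite rE natrM dk0 mulr0 eqxx.
split.
- exact: (span_Phi hd2 omega_ord omegaT).
- exact: (frame_identity hd2 omega_ord omegaT).
- by move=> xy; apply: hform_Phi.
Qed.
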